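(* Let $n\geq1$, $r=2^n$ and $M=10^{2^n}+1$. Let $\pi=1-\zeta_5-\zeta_5^3\in\mathbb{Z}[\zeta_{10}]$ and $\alpha=(\pi/\bar\pi)^{1+3\sigma_{-3}}$. For $k\geq0$ define $S_k^{(1)}=\alpha_1^{(k)}+\alpha_2^{(k)}$ and $S_k^{(2)}=\alpha_1^{(k)}\cdot\alpha_2^{(k)}$, where $\alpha_1^{(k)}=\alpha^{10^k}+\bar\alpha^{10^k}$ and $\alpha_2^{(k)}=\sigma_3(\alpha_1^{(k)})$. Suppose that every integer $x$ with $1<x<5^r$ and $x^4\equiv1\pmod{5^r}$ does not divide $M$. Then $M$ is prime if and only if $S_{r-1}^{(1)}\equiv1\pmod M$ and $S_{r-1}^{(2)}\equiv-1\pmod M$.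
   Context: $\zeta_m=e^{2\pi\sqrt{-1}/m}$ and a bar denotes complex conjugation. For $c$ coprime to $10$, $\sigma_c\in G=\mathrm{Gal}(\mathbb{Q}(\zeta_{10})/\mathbb{Q})$ sends $\zeta_{10}$ to $\zeta_{10}^c$; $1$ denotes $\sigma_1$ in $\mathbb{Z}[G]$. For $\tau=\sum_{\sigma\in G}k_\sigma\sigma\in\mathbb{Z}[G]$ and $\beta\neq0$, $\beta^\tau:=\prod_{\sigma}\sigma(\beta)^{k_\sigma}$. The $S_k^{(j)}$ are rational numbers with denominators prime to $M$; congruences modulo $M$ are understood in the ring of rationals with denominator prime to $M$. *)

(* Defs.v *)
From HB Require Import structures.
From mathcomp Require Import all_boot all_order all_algebra all_fingroup all_field.
From mathcomp Require Import complex.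
From mathcomp Require Import all_classical all_reals all_analysis.

Set Implicit Arguments.
Unset Strict Implicit.
Unset Printing Implicit Defensive.

Import Order.TTheory GRing.Theory Num.Theory.
Local Open Scope ring_scope.

Section ComplexZeta.
Variable R : realType.
Local Open Scope complex_scope.

Definition cexp (z : R[i]) : R[i] :=
  (expR (complex.Re z))%:C * (cos (complex.Im z) +i* sin (complex.Im z)).

Definition zetaC (m : nat) : R[i] := cexp (0 +i* (2 * pi / m%:R)).

End ComplexZeta.

(* The number field Q(zeta_m) is represented by any extension L of rat, with an
   embedding toC into the complex numbers, that is generated over rat by an
   element mapped to zeta_m; toC then identifies L with Q(zeta_m). *)
Definition is_cyclotomic_field (R : realType) (m : nat)
    (L : splittingFieldType rat) (toC : {rmorphism L -> R[i]}) : Prop :=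
  exists2 z : L, toC z = zetaC R m & <<1; z>>%VS = {:L}%VS.

Section Cyclotomic.
Variables (R : realType) (L : splittingFieldType rat).
Variable toC : {rmorphism L -> R[i]}.

(* The element of L with complex value w, or 0 if w is not in the image of
   toC. It is unique since toC is injective. *)
Definition ofC (w : R[i]) : L := xget 0 [set y : L | toC y = w]%classic.

Definition zeta (m : nat) : L := ofC (zetaC R m).

(* A cyclotomic field is stable under complex conjugation, so the default
   value 0 of ofC is not used here. *)
Definition bar (x : L) : L := ofC (toC x)^*.

(* The default value 1 is only used if c is not coprime to 10. *)
Definition sigma (c : int) : gal_of {:L} :=
  odflt 1%g [pick s in 'Gal({:L} / 1)%g | s (zeta 10) == zeta 10 ^ c].

(* The additive group of Z[G], for G = Gal(L/Q), is {ffun gal_of {:L} -> int};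
   galZ s is the group element s seen in Z[G]. *)
Definition galZ (s : gal_of {:L}) : {ffun gal_of {:L} -> int} :=
  [ffun t => (t == s)%:R].

Definition galpow (b : L) (tau : {ffun gal_of {:L} -> int}) : L :=
  \prod_(s in 'Gal({:L} / 1)%g) s b ^ tau s.

Definition pi0 : L := 1 - zeta 5 - zeta 5 ^+ 3.

Definition alpha : L :=
  galpow (pi0 / bar pi0) (galZ (sigma 1) + galZ (sigma (- 3)) *+ 3).

Definition alpha1 (k : nat) : L := alpha ^+ (10 ^ k) + bar alpha ^+ (10 ^ k).
Definition alpha2 (k : nat) : L := sigma 3 (alpha1 k).

Definition S1 (k : nat) : L := alpha1 k + alpha2 k.
Definition S2 (k : nat) : L := alpha1 k * alpha2 k.

End Cyclotomic.

(* The rationals with denominator prime to M. *)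
Definition Zloc (M : nat) : {pred rat} := fun q => coprime `|denq q|%N M.

Definition eqmod_loc (M : nat) (a b : rat) : Prop :=
  exists2 c : rat, c \in Zloc M & a - b = M%:R * c.

(* Congruence modulo M of two elements of L that are rational numbers with
   denominators prime to M; this membership is part of the relation. *)
Definition eqmodL (L : splittingFieldType rat) (M : nat) (x y : L) : Prop :=
  exists a b : rat, [/\ x = a%:A, y = b%:A, a \in Zloc M, b \in Zloc M
                      & eqmod_loc M a b].

(* Main.v *)
Require Import Defs.
From HB Require Import structures.
From mathcomp Require Import all_boot all_order all_algebra all_fingroup all_field.
From mathcomp Require Import complex.
From mathcomp Require Import all_classical all_reals all_analysis.
From mathcomp Require Import cyclic ring lra zify.

Set Implicit Arguments.
Unset Strict Implicit.
Unset Printing Implicit Defensive.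

Import Order.TTheory GRing.Theory Num.Theory.
Local Open Scope ring_scope.

(* Write N = 10^(r-1). Modulo a prime q, everything depends on the N-th powers
   of the reductions of the conjugates of alpha. If M is prime, the tenth
   power of a Gauss sum of order 10 over F_11 is, up to a unit and a tenth
   power, alpha (Stickelberger), and Frobenius, which acts on the Gauss sum
   through the residue M = 2 modulo 11, gives alpha^N = - zeta_5; both
   congruences follow. Conversely, the two congruences force alpha^N to be a
   primitive tenth root of unity modulo every prime q dividing M, so 5^r
   divides the order of alpha and hence q^4 - 1. By the hypothesis on divisors
   q >= 5^r, whereas the least prime divisor of a composite M satisfies q^2 <=
   M < 25^r. *)

(** * Identities over any field containing a root of the fifth cyclotomic polynomial *)

Section RootPhi5.
Variable F : fieldType.
Implicit Types w v t : F.

(** The fifth cyclotomic equation, solved for its leading monomial so that [ring] can reduce with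
    it. *)
Definition rootPhi5 w := w ^+ 4 = - (1 + w + w ^+ 2 + w ^+ 3).

Definition piF w := 1 - w - w ^+ 3.

(* The element alpha of the paper is alphaF (zeta 5), since sigma_(-3) squares
   zeta_5. *)
Definition alphaF w := piF w / piF (w ^+ 4) * (piF (w ^+ 2) / piF (w ^+ 3)) ^+ 3.

Lemma rootPhi5_exp5 w : rootPhi5 w -> w ^+ 5 = 1.
Proof. by rewrite /rootPhi5 => Hw; ring: Hw. Qed.

Lemma rootPhi5_exp2 w : rootPhi5 w -> rootPhi5 (w ^+ 2).
Proof. by rewrite /rootPhi5 => Hw; ring: Hw. Qed.

Lemma rootPhi5_exp3 w : rootPhi5 w -> rootPhi5 (w ^+ 3).
Proof. by rewrite /rootPhi5 => Hw; ring: Hw. Qed.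

Lemma rootPhi5_exp4 w : rootPhi5 w -> rootPhi5 (w ^+ 4).
Proof. by rewrite /rootPhi5 => Hw; ring: Hw. Qed.

(** The factors are the conjugates of pi, which has norm 11; hence all denominators below are powers
    of 11. *)
Lemma norm_piF w : rootPhi5 w ->
  piF w * piF (w ^+ 2) * piF (w ^+ 3) * piF (w ^+ 4) = 11%:R.
Proof. by rewrite /rootPhi5 /piF => Hw; ring: Hw. Qed.

Lemma piF_neq0 w : rootPhi5 w -> 11%:R != 0 :> F ->
  [/\ piF w != 0, piF (w ^+ 2) != 0, piF (w ^+ 3) != 0 & piF (w ^+ 4) != 0].
Proof.
by move=> /norm_piF <-; rewrite !mulf_eq0 !negb_or => /andP[/andP[/andP[]]].
Qed.

(* The Gauss sum over F_11 of the multiplicative character mapping 2 to v, where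
   t is an 11th root of unity: the exponents of t are the powers of 2. *)
Definition gauss11 v t :=
  t + v * t ^+ 2 + v ^+ 2 * t ^+ 4 + v ^+ 3 * t ^+ 8 + v ^+ 4 * t ^+ 5
  + v ^+ 5 * t ^+ 10 + v ^+ 6 * t ^+ 9 + v ^+ 7 * t ^+ 7 + v ^+ 8 * t ^+ 3
  + v ^+ 9 * t ^+ 6.

(** Meant for Gauss sums: [gk] belongs to the k-th power of a character of order 10, and [a], [b],
    [c] are Jacobi sums. Since 8 + 2 = 10, the remaining factor [g8 * g2] pairs inverse
    characters. *)
Lemma exp10_of_squares (a b c g1 g2 g4 g8 : F) :
  g1 ^+ 2 = a * g2 -> g2 ^+ 2 = b * g4 -> g4 ^+ 2 = c * g8 ->
  g1 ^+ 10 = a ^+ 5 * b ^+ 2 * c * (g8 * g2).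
Proof.
move=> e1 e2 e4.
have -> : g1 ^+ 10 = (g1 ^+ 2) ^+ 5 by ring.
have -> : (g1 ^+ 2) ^+ 5 = a ^+ 5 * (g2 ^+ 2) ^+ 2 * g2 by rewrite e1; ring.
have -> : (g2 ^+ 2) ^+ 2 = b ^+ 2 * g4 ^+ 2 by rewrite e2; ring.
by rewrite e4; ring.
Qed.

(* For the character mapping 2 to [v = - w ^+ 4], the squares [v ^+ 2], [v ^+ 4],
   [v ^+ 8] are [w ^+ 3], [w], [w ^+ 2]; the coefficients in J1, J2, J4 are the
   Jacobi sums. *)
Lemma gauss11_exp10 w t : rootPhi5 w ->
  t ^+ 10 = - (1 + t + t ^+ 2 + t ^+ 3 + t ^+ 4 + t ^+ 5 + t ^+ 6 + t ^+ 7
               + t ^+ 8 + t ^+ 9) ->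
  gauss11 (- w ^+ 4) t ^+ 10
  = - w ^+ 4 * piF w * piF (w ^+ 2) ^+ 3 * piF (w ^+ 3) ^+ 7 * piF (w ^+ 4) ^+ 9.
Proof.
rewrite /rootPhi5 => Hw Ht.
have J1 : gauss11 (- w ^+ 4) t ^+ 2 = (- 2 + 2 * w + w ^+ 2) * gauss11 (w ^+ 3) t.
  by rewrite /gauss11; ring: Hw Ht.
have J2 : gauss11 (w ^+ 3) t ^+ 2 = (1 - w + w ^+ 2 + 3 * w ^+ 3) * gauss11 w t.
  by rewrite /gauss11; ring: Hw Ht.
have J4 : gauss11 w t ^+ 2 = (2 * w - 2 * w ^+ 2 - w ^+ 3) * gauss11 (w ^+ 2) t.
  by rewrite /gauss11; ring: Hw Ht.
(* The two characters are inverse to each other and take the value 1 at -1 = 2^5, whence the product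
   11. *)
have J8 : gauss11 (w ^+ 2) t * gauss11 (w ^+ 3) t = 11%:R.
  by rewrite /gauss11; ring: Hw Ht.
rewrite (exp10_of_squares J1 J2 J4).
by rewrite J8 /piF; ring: Hw.
Qed.

(** Replacing 11 by the norm of pi cancels the denominator, of degree 4 in the conjugates of pi; the
    four constants are the coordinates of the resulting product in the basis 1, w, w^2, w^3. *)
Lemma alphaF_int w : rootPhi5 w -> 11%:R != 0 :> F ->
  11%:R ^+ 3 * alphaF w = 1520 + 756 * w + 1005 * w ^+ 2 + 300 * w ^+ 3.
Proof.
move=> Hw n11; have N := norm_piF Hw.
have [_ _ p3 p4] := piF_neq0 Hw n11.
transitivity (piF w ^+ 4 * piF (w ^+ 2) ^+ 6 * piF (w ^+ 4) ^+ 2).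
  rewrite -N /alphaF; field; by rewrite p3 p4.
by move: Hw; rewrite /rootPhi5 /piF => Hw; ring: Hw.
Qed.

(** Complex conjugation, w to w^4, exchanges numerator and denominator in both quotients defining
    [alphaF]. *)
Lemma alphaF_norm w : rootPhi5 w -> 11%:R != 0 :> F ->
  alphaF w * alphaF (w ^+ 4) = 1.
Proof.
move=> Hw n11.
have [p1 p2 p3 p4] := piF_neq0 Hw n11.
have e5 := rootPhi5_exp5 Hw.
rewrite /alphaF -!exprM -(expr_mod (4 * 4) e5) -(expr_mod (4 * 2) e5) -(expr_mod (4 * 3) e5).
rewrite /= expr1.
field; by rewrite p1 p2 p3 p4.
Qed.
End RootPhi5.

(** * Integer formulas for the two sums, uniform over all fields *)

Lemma quad_exp (c0 c1 c2 c3 : int) (N : nat) : exists d0 d1 d2 d3 : int,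
  forall (F : fieldType) (w : F), rootPhi5 w ->
  (c0%:~R + c1%:~R * w + c2%:~R * w ^+ 2 + c3%:~R * w ^+ 3) ^+ N
  = d0%:~R + d1%:~R * w + d2%:~R * w ^+ 2 + d3%:~R * w ^+ 3.
Proof.
elim: N => [|N [d0 [d1 [d2 [d3 IH]]]]].
  by exists 1, 0, 0, 0 => F w Hw; rewrite expr0; ring.
(* Reduce the product with w^4 = -(1+w+w^2+w^3). *)
pose e4 := c1 * d3 + c2 * d2 + c3 * d1.
exists (c0 * d0 - e4 + (c2 * d3 + c3 * d2)),
  (c0 * d1 + c1 * d0 - e4 + c3 * d3),
  (c0 * d2 + c1 * d1 + c2 * d0 - e4),
  (c0 * d3 + c1 * d2 + c2 * d1 + c3 * d0 - e4) => F w Hw.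
rewrite exprS IH // /e4; move: Hw; rewrite /rootPhi5 => Hw.
by ring: Hw.
Qed.

Lemma rmorph_piF (F K : fieldType) (f : {rmorphism F -> K}) w :
  f (piF w) = piF (f w).
Proof. by rewrite /piF !rmorphB rmorph1 rmorphXn. Qed.

Lemma rmorph_alphaF (F K : fieldType) (f : {rmorphism F -> K}) w :
  f (alphaF w) = alphaF (f w).
Proof. by rewrite /alphaF rmorphM rmorphXn !fmorph_div !rmorph_piF !rmorphXn. Qed.

Lemma rmorph_gauss11 (F K : fieldType) (f : {rmorphism F -> K}) v t :
  f (gauss11 v t) = gauss11 (f v) (f t).
Proof. by rewrite /gauss11 !rmorphD !(rmorphXn, rmorphM). Qed.

Lemma rootPhi5_expn (F : fieldType) (w : F) i : rootPhi5 w -> w ^+ i = w ^+ (i %% 5).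
Proof. by move=> /rootPhi5_exp5 w5; rewrite expr_mod. Qed.

Section SumProduct.
Variable F : fieldType.

(** For N = 10^k this and [S2F] are the two sequences of the theorem: sigma_3 replaces the conjugate
    pair w, w^4 by w^3, w^2. *)
Definition S1F (w : F) N :=
  alphaF w ^+ N + alphaF (w ^+ 4) ^+ N + (alphaF (w ^+ 3) ^+ N + alphaF (w ^+ 2) ^+ N).
Definition S2F (w : F) N :=
  (alphaF w ^+ N + alphaF (w ^+ 4) ^+ N) * (alphaF (w ^+ 3) ^+ N + alphaF (w ^+ 2) ^+ N).

End SumProduct.

(* The same integers serve in all characteristics: this carries the congruences
   from Q(zeta_10) to fields of characteristic q. *)
Lemma S12F_int N : exists m1 m2 : int, forall (F : fieldType) (w : F),
  rootPhi5 w -> 11%:R != 0 :> F ->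
  11%:R ^+ (3 * N * 2) * S1F w N = m1%:~R /\ 11%:R ^+ (3 * N * 2) * S2F w N = m2%:~R.
Proof.
have [c0 [c1 [c2 [c3 E]]]] := quad_exp 1520 756 1005 300 N.
(* A sum of two complex conjugates is a + b s with s = w + w^4, because w^2 + w^3 = -1 - s. *)
pose a := 2 * c0 - c2 - c3; pose b := c1 - c2 - c3.
(* Trace and norm of a + b s, as s and its conjugate have sum and product -1. The extra power of 11
   gives both sums the same denominator. *)
exists (11 ^+ (3 * N) * (2 * a - b)), (a ^+ 2 - a * b - b ^+ 2) => F w Hw n11.
have A (x : F) : rootPhi5 x ->
    11%:R ^+ (3 * N) * alphaF x ^+ N
    = c0%:~R + c1%:~R * x + c2%:~R * x ^+ 2 + c3%:~R * x ^+ 3.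
  by move=> Hx; rewrite -E // exprM -exprMn alphaF_int //.
have T1 : 11%:R ^+ (3 * N) * (alphaF w ^+ N + alphaF (w ^+ 4) ^+ N)
    = a%:~R + b%:~R * (w + w ^+ 4).
  rewrite mulrDr !A //; last exact: rootPhi5_exp4.
  by move: Hw; rewrite /rootPhi5 /a /b => Hw; ring: Hw.
have T2 : 11%:R ^+ (3 * N) * (alphaF (w ^+ 3) ^+ N + alphaF (w ^+ 2) ^+ N)
    = a%:~R + b%:~R * (w ^+ 2 + w ^+ 3).
  rewrite mulrDr !A //; [|exact: rootPhi5_exp2|exact: rootPhi5_exp3].
  by move: Hw; rewrite /rootPhi5 /a /b => Hw; ring: Hw.
split.
  rewrite exprM expr2 -mulrA /S1F mulrDr T1 T2 rmorphM rmorphXn /=; congr (_ * _).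
  by move: Hw; rewrite /rootPhi5 /a /b => Hw; ring: Hw.
rewrite exprM expr2 /S2F mulrACA T1 T2.
by move: Hw; rewrite /rootPhi5 /a /b => Hw; ring: Hw.
Qed.

(** * Characteristic p: Frobenius and the Gauss sum *)

Lemma exists_roots_pchar p : prime p -> exists (K : fieldType) (w t : K),
  [/\ p \in [pchar K], rootPhi5 w &
      t ^+ 10 = - (1 + t + t ^+ 2 + t ^+ 3 + t ^+ 4 + t ^+ 5 + t ^+ 6 + t ^+ 7
               + t ^+ 8 + t ^+ 9)].
Proof.
move=> pp; have [K [f _]] := countable_algebraic_closure 'F_p.
have [w Hw] := @solve_monicpoly K 4 (fun=> -1) isT.
have [t Ht] := @solve_monicpoly K 10 (fun=> -1) isT.
exists K, w, t; split.
- by rewrite (rmorph_pchar f) // pchar_Fp.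
- by rewrite /rootPhi5 Hw !big_ord_recr big_ord0 /=; ring.
- by rewrite Ht !big_ord_recr big_ord0 /=; ring.
Qed.

Section PositiveCharacteristic.
Variables (K : fieldType) (p : nat).
Hypothesis pK : p \in [pchar K].

Lemma piF_pchar w : piF w ^+ p = piF (w ^+ p) :> K.
Proof. exact: rmorph_piF (pFrobenius_aut pK) w. Qed.

Lemma alphaF_pchar w : alphaF w ^+ p = alphaF (w ^+ p) :> K.
Proof. exact: rmorph_alphaF (pFrobenius_aut pK) w. Qed.

Lemma pchar_gauss11 v t : gauss11 v t ^+ p = gauss11 (v ^+ p) (t ^+ p) :> K.
Proof. exact: rmorph_gauss11 (pFrobenius_aut pK) v t. Qed.

Lemma natr_pchar_neq0 m : coprime m p -> m%:R != 0 :> K.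
Proof.
move=> co; rewrite -(dvdn_pcharf pK) -prime_coprime ?(pcharf_prime pK) // coprime_sym //.
Qed.

(* As p = 2 modulo 11, Frobenius multiplies the Gauss sum by the value at 2 of
   the inverse character. *)
Lemma alphaF_exp (w t : K) (r : nat) : rootPhi5 w ->
  t ^+ 10 = - (1 + t + t ^+ 2 + t ^+ 3 + t ^+ 4 + t ^+ 5 + t ^+ 6 + t ^+ 7
               + t ^+ 8 + t ^+ 9) ->
  (1 < r)%N -> p = (10 ^ r + 1)%N -> p = 2 %[mod 11] ->
  alphaF w ^+ (10 ^ (r - 1)) = - w.
Proof.
move=> Hw Ht r1 pE p11.
have w5 := rootPhi5_exp5 Hw.
have t11 : t ^+ 11 = 1 by ring: Ht.
have p10 : (p %% 10 = 1)%N.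
  by rewrite pE -(subnK (ltnW r1)) expnD expn1 modnMDl.
have wp (x : K) : x ^+ 10 = 1 -> x ^+ p = x by move=> x10; rewrite -(expr_mod _ x10) p10.
have v10 : (- w ^+ 4) ^+ 10 = 1 by rewrite exprNn -exprM (exprM w 5 8) w5 expr1n mulr1 -signr_odd.
set g := gauss11 (- w ^+ 4) t.
have gp : g ^+ p = - w * g.
  rewrite pchar_gauss11 wp // -(expr_mod _ t11) p11 /g /gauss11.
  by ring: w5 t11.
have n11 : 11%:R != 0 :> K.
  by apply: natr_pchar_neq0; rewrite -coprime_modr p11.
have g10 := gauss11_exp10 Hw Ht; rewrite -/g in g10.
have [p1 p2 p3 p4] := piF_neq0 Hw n11.
have w0 : w != 0 by apply: contra_eq_neq w5 => ->; rewrite expr0n eq_sym oner_neq0.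
have g0 : g != 0.
  have : g ^+ 10 != 0.
    rewrite g10; apply: mulf_neq0 (expf_neq0 _ p4); apply: mulf_neq0 (expf_neq0 _ p3).
    apply: mulf_neq0 (expf_neq0 _ p2); apply: mulf_neq0 p1.
    by rewrite oppr_eq0 expf_neq0.
  by rewrite expf_eq0.
have gr : g ^+ (10 ^ r) = - w.
  by apply: (mulIf g0); rewrite -gp pE addn1 exprSr.
(* As p is 1 modulo 10, Frobenius fixes [piF x], and p - 1 = 10^r. *)
have piw (x : K) : x ^+ 10 = 1 -> piF x != 0 -> piF x ^+ (10 ^ r) = 1.
  move=> x10 px0; apply: (mulIf px0).
  have pS : p = (10 ^ r).+1 by rewrite pE addn1.
  rewrite mul1r -exprSr -pS.
  by rewrite piF_pchar wp.
have wX k : (w ^+ k) ^+ 10 = 1 by rewrite exprAC (exprM w 5 2) w5 !expr1n.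
have gE : g ^+ 10 = - w ^+ 4 * alphaF w * (piF (w ^+ 3) * piF (w ^+ 4)) ^+ 10.
  rewrite g10 /alphaF; field; by rewrite p3 p4.
have rE : (10 ^ r = 10 * 10 ^ (r - 1))%N by rewrite -expnS subn1 prednK // ltnW.
rewrite -gr rE exprM gE; set P := piF (w ^+ 3) * piF (w ^+ 4).
have P1 : (P ^+ 10) ^+ (10 ^ (r - 1)) = 1 by rewrite -exprM -rE exprMn !piw // mul1r.
rewrite (exprMn _ _ (P ^+ 10)) P1 mulr1.
rewrite (exprMn _ (- w ^+ 4)).
rewrite -[LHS]mul1r; congr (_ * _).
(* Because r > 1, the exponent 10^(r-1) is a multiple of 10, which kills the unit [- w ^+ 4]. *)
have -> : (r - 1 = (r - 2).+1)%N by lia.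
by rewrite expnS exprM v10 expr1n.
Qed.
End PositiveCharacteristic.

Lemma S12F_of_prime (p r : nat) : prime p -> (1 < r)%N -> p = (10 ^ r + 1)%N ->
  p = 2 %[mod 11] -> exists (K : fieldType) (w : K),
  [/\ p \in [pchar K], rootPhi5 w, S1F w (10 ^ (r - 1)) = 1 & S2F w (10 ^ (r - 1)) = - 1].
Proof.
move=> pp r1 pE p11; have [K [w [t [pK Hw Ht]]]] := exists_roots_pchar pp.
exists K, w; have E x (Hx : rootPhi5 x) := alphaF_exp pK Hx Ht r1 pE p11.
have [H2 H3 H4] := And3 (rootPhi5_exp2 Hw) (rootPhi5_exp3 Hw) (rootPhi5_exp4 Hw).
rewrite /S1F /S2F !E //; split=> //; move: Hw; rewrite /rootPhi5 => Hw; by ring: Hw.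
Qed.

(** * From the values of the two sums to the order of alpha *)

Lemma S12F_exp5 (F : fieldType) (w : F) N : rootPhi5 w -> 11%:R != 0 :> F ->
  S1F w N = 1 -> S2F w N = - 1 ->
  exists2 x : F, rootPhi5 x & alphaF w ^+ N = - x.
Proof.
move=> Hw n11; rewrite /S1F /S2F.
have : alphaF w ^+ N * alphaF (w ^+ 4) ^+ N = 1.
  by rewrite -exprMn alphaF_norm // expr1n.
move: (alphaF w ^+ N) (alphaF (w ^+ 4) ^+ N) => u u' uu.
move: (alphaF (w ^+ 3) ^+ N + alphaF (w ^+ 2) ^+ N) => y s1 s2.
have yE : y = 1 - (u + u') by rewrite -s1; ring.
(* Sum 1 and product -1 make u + u' a root of Y^2 - Y - 1, which splits through the two periods of
   w. *)
have : (u + u' + (w + w ^+ 4)) * (u + u' + (w ^+ 2 + w ^+ 3)) = 0.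
  transitivity ((u + u') ^+ 2 - (u + u') - 1).
    by move: Hw; rewrite /rootPhi5 => Hw; ring: Hw.
  have -> : (u + u') ^+ 2 - (u + u') = - ((u + u') * y) by rewrite yE; ring.
  by rewrite s2; ring.
have root_u x : rootPhi5 x -> u + u' + (x + x ^+ 4) = 0 ->
    exists2 z : F, rootPhi5 z & u = - z.
  move=> Hx e0; have x5 := rootPhi5_exp5 Hx.
  (* As u u' = 1, u is a root of Y^2 + (x + x^4) Y + 1 = (Y + x)(Y + x^4). *)
  have : (u + x) * (u + x ^+ 4) = 0.
    transitivity (u * (u + u' + (x + x ^+ 4)) + (1 - u * u') + (x ^+ 5 - 1)); first by ring.
    by rewrite e0 uu x5; ring.
  move/eqP; rewrite mulf_eq0 !addr_eq0 => /orP[] /eqP ->.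
    by exists x.
  by exists (x ^+ 4) => //; apply: rootPhi5_exp4.
move/eqP; rewrite mulf_eq0 => /orP[] /eqP; first exact: root_u.
rewrite [w ^+ 2 + _]addrC.
have -> : w ^+ 2 = (w ^+ 3) ^+ 4.
  by move: Hw; rewrite /rootPhi5 => Hw; ring: Hw.
by apply: root_u; apply: rootPhi5_exp3.
Qed.

(** Four applications of Frobenius fix w and hence alpha, while a suitable power of alpha has order
    exactly 5^(s+1). *)
Lemma dvdn_pchar_order (K : fieldType) (w : K) (q s : nat) :
  q \in [pchar K] -> rootPhi5 w -> coprime q 110 ->
  S1F w (10 ^ s) = 1 -> S2F w (10 ^ s) = - 1 ->
  (5 ^ s.+1 %| q ^ 4 - 1)%N.
Proof.
move=> qK Hw co s1 s2; have qp := pcharf_prime qK.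
have nz m : (m %| 110)%N -> m%:R != 0 :> K.
  by move=> dm; apply: (natr_pchar_neq0 qK); rewrite coprime_sym; apply: coprime_dvdr co.
have n11 : 11%:R != 0 :> K by exact: nz.
have w5 := rootPhi5_exp5 Hw.
have [x Hx ax] := S12F_exp5 Hw n11 s1 s2.
have x5 := rootPhi5_exp5 Hx.
(* Only in characteristic 5 could x be 1, and q is prime to 110. *)
have x1 : x ^+ 2 != 1.
  apply/negP => /eqP x2.
  have x1 : x = 1 by rewrite -x5 (exprS x 4) (exprM x 2 2) x2 expr1n mulr1.
  have /eqP[] := nz 5 isT.
  transitivity (x ^+ 4 + (1 + x + x ^+ 2 + x ^+ 3)); first by rewrite x1; ring.
  by rewrite Hx addNr.
have an1 := alphaF_norm Hw n11.
have a0 : alphaF w != 0.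
  by apply: contra_eq_neq an1 => ->; rewrite mul0r eq_sym oner_neq0.
(* This power removes the 2-part of the order: b^(5^s) is x^2 and b^(5^(s+1)) is x^10. *)
pose b := alphaF w ^+ (2 ^ s.+1).
have e10 : (10 ^ s * 2 = 2 ^ s.+1 * 5 ^ s)%N.
  by rewrite (_ : 10 = 2 * 5)%N // expnMn mulnC mulnA -expnS.
have b1 : b ^+ (5 ^ s) != 1.
  by rewrite /b -exprM -e10 exprM ax sqrrN.
have b2 : b ^+ (5 ^ s.+1) = 1.
  rewrite expnS mulnC exprM /b -(exprM _ (2 ^ s.+1)) -e10 exprM ax sqrrN.
  by rewrite exprAC x5 expr1n.
have wq : w ^+ (q ^ 4) = w.
  rewrite -(expr_mod _ w5) (_ : (q ^ 4 %% 5 = 1)%N) //.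
  have q5 : coprime q 5 by apply: coprime_dvdr co.
  by have := Euler_exp_totient q5.
have aq : alphaF w ^+ (q ^ 4) = alphaF w.
  by rewrite -{2}wq !expnS expn0 muln1 !exprM !(alphaF_pchar qK).
have bq : b ^+ (q ^ 4 - 1) = 1.
  rewrite /b -exprM mulnC exprM.
  suff -> : alphaF w ^+ (q ^ 4 - 1) = 1 by rewrite expr1n.
  apply: (mulIf a0); rewrite mul1r -exprSr -addn1 subnK //.
  by rewrite expn_gt0 prime_gt0.
have [m mb md] := prim_order_exists (expn_gt0 5 s.+1 : (0 < 5 ^ s.+1)%N) b2.
have /(dvdn_pfactor m s.+1 (isT : prime 5))[k kr mE] := md.
suff km : k = s.+1 by rewrite -km -mE (prim_order_dvd mb) bq.
apply/eqP; rewrite eqn_leq kr leqNgt /=; apply: contra b1 => lkr.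
rewrite -(prim_order_dvd mb) mE; apply: dvdn_exp2l; lia.
Qed.

(** * Galois action on the primitive fifth roots of unity *)

Lemma gal_rootPhi5 (L : splittingFieldType rat) (w w' : L) :
  rootPhi5 w -> rootPhi5 w' ->
  exists2 s, s \in 'Gal({:L} / 1)%g & s w = w'.
Proof.
move=> Hw Hw'.
(* The shift by 1 makes the cyclotomic polynomial Eisenstein at 5. *)
pose e : {poly int} := Poly [:: 5; 10; 10; 5; 1].
have eE : e = [:: 5; 10; 10; 5; 1] :> seq int by rewrite (@PolyK _ 0).
have irr_e : irreducible_poly (map_poly (intr : int -> rat) e).
  apply/irreducible_rat_int; apply: (@eisenstein_crit 5);
    rewrite ?lead_coefE ?eE //.
  by move=> [|[|[|[|]]]].
have root_e (x : L) : rootPhi5 x ->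
    root (map_poly (in_alg L) (map_poly (intr : int -> rat) e)) (x - 1).
  move=> Hx; rewrite -map_poly_comp /= rootE.
  have -> : map_poly (in_alg L \o intr) e = map_poly intr e.
    by apply: eq_map_poly => i; apply: (rmorph_int (in_alg L)).
  rewrite horner_poly eE /= !big_ord_recr big_ord0 /=.
  by apply/eqP; move: Hx; rewrite /rootPhi5 => Hx; ring: Hx.
have /polyOver1P[q qE] := minPolyOver 1 (w - 1).
have q_dvd : q %| map_poly (intr : int -> rat) e.
  by rewrite -(dvdp_map (in_alg L)) -qE minPoly_dvdp ?alg_polyOver ?root_e.
have q1 : size q != 1%N.
  have := root_size_gt1 (monic_neq0 (monic_minPoly 1 (w - 1))) (root_minPoly _ _).
  by rewrite qE size_map_poly; case: (size q) => [|[]].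
have e_q := irr_e.2 q q1 q_dvd.
have : root (minPoly 1 (w - 1)) (w' - 1).
  by rewrite qE (eqp_root (_ : _ %= map_poly (in_alg L) (map_poly intr e))) ?root_e // eqp_map.
case/(normalField_root_minPoly (sub1v _) (normalFieldf _) (memvf _)) => s sG sw.
by exists s => //; move: sw; rewrite rmorphB rmorph1 => /(addIr (- 1)).
Qed.

(** * Complex roots of unity of orders 5 and 10 *)

Section ComplexValues.
Variable R : realType.
Local Open Scope complex_scope.

Lemma cis_exp (a : R) n :
  (cos a +i* sin a) ^+ n = cos (a *+ n) +i* sin (a *+ n).
Proof.
elim: n => [|n IH]; first by rewrite expr0 mulr0n cos0 sin0.
by rewrite exprSr IH mulrSr cosD sinD [LHS]/GRing.mul /= [sin _ * cos _ + _]addrC.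
Qed.

Lemma zetaCE m : zetaC R m = cos (2 * pi / m%:R) +i* sin (2 * pi / m%:R).
Proof. by rewrite /zetaC /cexp /= expR0 mul1r. Qed.

Lemma zetaC10_exp2 : zetaC R 10 ^+ 2 = zetaC R 5.
Proof.
rewrite !zetaCE cis_exp.
have -> : (2 * pi / 10%:R) *+ 2 = 2 * pi / 5%:R :> R by field.
by [].
Qed.

Lemma zetaC10_exp5 : zetaC R 10 ^+ 5 = - 1.
Proof.
rewrite zetaCE cis_exp.
have -> : (2 * pi / 10%:R) *+ 5 = pi :> R by field.
by rewrite cospi sinpi; apply/eqP; rewrite eq_complex /= oppr0 !eqxx.
Qed.

Lemma zetaC10_neqN1 : zetaC R 10 != - 1.
Proof.
rewrite zetaCE eq_complex /= negb_and orbC oppr0 gt_eqF //.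
have pi0 := pi_gt0 R; apply: sin_gt0_pi; apply/andP; split; last by lra.
by rewrite divr_gt0 ?mulr_gt0.
Qed.

End ComplexValues.

Lemma conj_unity_root (C : numClosedFieldType) (x : C) n :
  (0 < n)%N -> x ^+ n = 1 -> x^* = x^-1.
Proof.
move=> n0 xn; have x1 : `|x| = 1.
  by apply/eqP; rewrite -(pexpr_eq1 n0) // -normrX xn normr1.
have x0 : x != 0 by rewrite -normr_eq0 x1 oner_neq0.
by apply: (mulfI x0); rewrite mulfV // -normCK x1 expr1n.
Qed.

(** * The two sequences computed in the field generated by zeta_10 *)

Section CyclotomicField.
Variables (R : realType) (L : splittingFieldType rat).
Variable toC : {rmorphism L -> R[i]}.

Lemma toCK y : ofC toC (toC y) = y.
Proof.
apply: (fmorph_inj toC); rewrite /ofC.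
exact: (@xgetPex _ 0 [set x | toC x = toC y]%classic (ex_intro _ y erefl)).
Qed.

Hypothesis hL : is_cyclotomic_field 10 toC.

Let z := zeta toC 10.
Let w := zeta toC 5.

Lemma toC_zeta10 : toC z = zetaC R 10.
Proof. by have [y yE _] := hL; rewrite /z /zeta -yE toCK. Qed.

Lemma zeta10_exp2 : z ^+ 2 = w.
Proof. by rewrite /w /zeta -zetaC10_exp2 -toC_zeta10 -rmorphXn toCK. Qed.

Lemma zeta10_exp5 : z ^+ 5 = - 1.
Proof.
by apply: (fmorph_inj toC); rewrite rmorphXn rmorphN1 toC_zeta10 zetaC10_exp5.
Qed.

Lemma zeta10_exp4 : z ^+ 4 = z ^+ 3 - z ^+ 2 + z - 1.
Proof.
have z5 := zeta10_exp5.
have z1 : z + 1 != 0.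
  rewrite addr_eq0 -(inj_eq (fmorph_inj toC)) rmorphN1 toC_zeta10.
  exact: zetaC10_neqN1.
by apply: (mulfI z1); ring: z5.
Qed.

Lemma rootPhi5_zeta5 : rootPhi5 w.
Proof.
have z4 := zeta10_exp4; rewrite -zeta10_exp2 /rootPhi5; ring: z4.
Qed.

Lemma toC_conj_zeta5 : (toC w)^* = toC (w ^+ 4).
Proof.
have w5 := rootPhi5_exp5 rootPhi5_zeta5.
have w0 : w != 0 by apply: contra_eq_neq w5 => ->; rewrite expr0n eq_sym oner_neq0.
rewrite (@conj_unity_root _ _ 5) //; last by rewrite -rmorphXn w5 rmorph1.
by rewrite -fmorphV; congr (toC _); apply: (mulfI w0); rewrite mulfV // -exprS.
Qed.

Lemma bar_piF : bar toC (piF w) = piF (w ^+ 4).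
Proof.
rewrite /bar -[_^*]/((Num.conj \o toC) (piF w)) rmorph_piF /= toC_conj_zeta5.
by rewrite -rmorph_piF toCK.
Qed.

Lemma bar_alphaF : bar toC (alphaF w) = alphaF (w ^+ 4).
Proof.
rewrite /bar -[_^*]/((Num.conj \o toC) (alphaF w)) rmorph_alphaF /= toC_conj_zeta5.
by rewrite -rmorph_alphaF toCK.
Qed.

(** Since zeta_10 = - zeta_5^3, an automorphism sending zeta_5 to y^2 sends zeta_10 to y. So the
    search in [sigma] succeeds and its default value is not reached. *)
Lemma sigma_zeta10 c (y : L) : z ^ c = y -> rootPhi5 (y ^+ 2) -> y ^+ 5 = - 1 ->
  sigma toC c z = y.
Proof.
move=> zc Hy y5; rewrite /sigma; case: pickP => [s /andP[_ /eqP ->] // | /=].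
have [s sG sw] := gal_rootPhi5 rootPhi5_zeta5 Hy.
have zE : z = - w ^+ 3 by rewrite -zeta10_exp2; have z5 := zeta10_exp5; ring: z5.
have sz : s z = y by rewrite zE rmorphN rmorphXn /= sw; ring: y5.
by move=> /(_ s); rewrite sG -/z zc sz eqxx.
Qed.

Lemma sigma1_zeta5 : sigma toC 1 w = w.
Proof.
have w2 := rootPhi5_zeta5; rewrite -zeta10_exp2 in w2.
have sz : sigma toC 1 z = z by apply: sigma_zeta10 zeta10_exp5; rewrite ?expr1z.
by rewrite -zeta10_exp2 rmorphXn /= sz.
Qed.

Lemma sigma3_zeta5 : sigma toC 3 w = w ^+ 3.
Proof.
have z5 := zeta10_exp5; have w2 := rootPhi5_exp3 rootPhi5_zeta5.
rewrite -zeta10_exp2 exprAC in w2.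
have sz : sigma toC 3 z = z ^+ 3 by apply: sigma_zeta10 w2 _ => //; ring: z5.
by rewrite -zeta10_exp2 rmorphXn /= sz exprAC.
Qed.

Lemma sigmaN3_zeta5 : sigma toC (- 3) w = w ^+ 2.
Proof.
have z5 := zeta10_exp5; have w2 := rootPhi5_exp2 rootPhi5_zeta5.
have z0 : z != 0.
  by apply: contra_eq_neq z5 => ->; rewrite expr0n eq_sym oppr_eq0 oner_neq0.
have zN3 : z ^ (- 3) = z ^+ 7.
  rewrite (_ : z ^ (- 3) = (z ^+ 3)^-1) //.
  by apply: (mulfI (expf_neq0 3 z0)); rewrite mulfV ?expf_neq0 //; ring: z5.
have z14 : (z ^+ 7) ^+ 2 = w ^+ 2 by rewrite -zeta10_exp2; ring: z5.
have sz : sigma toC (- 3) z = z ^+ 7.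
  by apply: sigma_zeta10 => //; [rewrite z14|ring: z5].
by rewrite -[in LHS]zeta10_exp2 rmorphXn /= sz.
Qed.

Lemma galpow_galZ (b : L) s : galpow b (galZ s) = s b.
Proof.
have sG : s \in 'Gal({:L} / 1)%g by rewrite gal_kHom ?sub1v // k1AHom.
rewrite /galpow (bigD1 s) //= ffunE eqxx expr1z big1 ?mulr1 // => t /andP[_ /negPf ts].
by rewrite ffunE ts expr0z.
Qed.

Lemma galpowD (b : L) t1 t2 : b != 0 -> galpow b (t1 + t2) = galpow b t1 * galpow b t2.
Proof.
move=> b0; rewrite /galpow -big_split; apply: eq_bigr => s _.
by rewrite ffunE expfzDr // fmorph_eq0.
Qed.

Lemma alphaE : alpha toC = alphaF w.
Proof.
have Hw := rootPhi5_zeta5.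
have n11 : 11%:R != 0 :> L by rewrite -(rmorph_nat (in_alg L)) fmorph_eq0 pnatr_eq0.
have [p1 p2 p3 p4] := piF_neq0 Hw n11.
rewrite /alpha -[pi0 toC]/(piF w) bar_piF.
have b0 : piF w / piF (w ^+ 4) != 0 by rewrite mulf_neq0 ?invr_neq0.
have E3 (t : {ffun gal_of {:L} -> int}) : t *+ 3 = t + (t + t) by [].
rewrite E3 !galpowD // !galpow_galZ !fmorph_div !rmorph_piF !rmorphXn /=.
rewrite sigma1_zeta5 sigmaN3_zeta5 /alphaF.
by rewrite -exprM (rootPhi5_expn (2 * 4) Hw) /=; ring.
Qed.

Lemma alpha1E k : alpha1 toC k = alphaF w ^+ (10 ^ k) + alphaF (w ^+ 4) ^+ (10 ^ k).
Proof. by rewrite /alpha1 alphaE bar_alphaF. Qed.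

Lemma alpha2E k :
  alpha2 toC k = alphaF (w ^+ 3) ^+ (10 ^ k) + alphaF (w ^+ 2) ^+ (10 ^ k).
Proof.
rewrite /alpha2 alpha1E rmorphD !rmorphXn !rmorph_alphaF rmorphXn /= sigma3_zeta5.
by rewrite -exprM (rootPhi5_expn (3 * 4) rootPhi5_zeta5).
Qed.

Lemma S1E k : S1 toC k = S1F w (10 ^ k).
Proof. by rewrite /S1 alpha1E alpha2E. Qed.

Lemma S2E k : S2 toC k = S2F w (10 ^ k).
Proof. by rewrite /S2 alpha1E alpha2E. Qed.

End CyclotomicField.

(** * Congruences between rationals with denominator prime to M *)

Lemma Zloc_frac M (i : int) (d : nat) : (0 < d)%N -> coprime d M ->
  i%:~R / d%:R \in Zloc M.
Proof.
move=> d0 dM; rewrite /Zloc -topredE /=.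
set x : rat := _ / _; apply: coprime_dvdl dM.
have d0' : d%:R != 0 :> rat by rewrite pnatr_eq0 -lt0n.
have den0 : (denq x)%:~R != 0 :> rat by rewrite intr_eq0 denq_neq0.
(* The reduced denominator, being prime to the numerator, therefore divides d. *)
have e : numq x * d%:Z = i * denq x.
  apply: (@intr_inj rat); rewrite !rmorphM /= -pmulrn numqE /x; field.
  exact: d0'.
have : (denq x %| numq x * d%:Z)%Z by rewrite e dvdz_mull.
by rewrite Gauss_dvdzr // coprimez_sym; exact: coprime_num_den.
Qed.

(** Clearing a denominator that is invertible modulo M leaves a divisibility of integers, which can
    be read in any field of characteristic dividing M. *)
Lemma eqmodL_int (L : splittingFieldType rat) M d (x : L) (m k : int) :
  (0 < d)%N -> coprime d M -> d%:R * x = m%:~R ->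
  eqmodL M x k%:~R <-> (M%:Z %| m - k * d%:Z)%Z.
Proof.
move=> d0 dM dx.
have d0Q : d%:R != 0 :> rat by rewrite pnatr_eq0 -lt0n.
have d0L : d%:R != 0 :> L by rewrite -(rmorph_nat (in_alg L)) fmorph_eq0.
have xE : x = (m%:~R / d%:R)%:A.
  apply: (mulfI d0L); rewrite dx -[_%:A]/(in_alg L _) -(rmorph_nat (in_alg L)).
  by rewrite -rmorphM mulrC divfK // rmorph_int.
have kE : k%:~R = (k%:~R : rat)%:A :> L by rewrite -[RHS]/(in_alg L _) rmorph_int.
split=> [[a [b [xa kb _ _ [c cM abc]]]] | /dvdzP[j jE]].
  have aE : a = m%:~R / d%:R by apply: (fmorph_inj (in_alg L)); rewrite /= -xa.
  have bE : b = k%:~R by apply: (fmorph_inj (in_alg L)); rewrite /= -kb.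
  have e : (m - k * d%:Z) * denq c = M%:Z * (numq c * d%:Z).
    apply: (@intr_inj rat); rewrite !rmorphM rmorphB rmorphM /= numqE -!pmulrn.
    have -> : m%:~R - k%:~R * d%:R = (a - b) * d%:R by rewrite aE bE; field.
    by rewrite abc; ring.
  have : (M%:Z %| (m - k * d%:Z) * denq c)%Z by rewrite e dvdz_mulr.
  by rewrite Gauss_dvdzl // coprimez_sym; exact: cM.
exists (m%:~R / d%:R), k%:~R; split=> //.
- exact: Zloc_frac.
- by have := Zloc_frac k (isT : 0 < 1)%N (coprime1n M); rewrite divr1.
exists (j%:~R / d%:R); first exact: Zloc_frac.
have -> : m = j * M%:Z + k * d%:Z by rewrite -jE subrK.
by rewrite rmorphD !rmorphM /= -!pmulrn; field.
Qed.

Theorem proposition4p2 (R : realType) (L : splittingFieldType rat)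
    (toC : {rmorphism L -> R[i]}) (hL : is_cyclotomic_field 10 toC)
    (n r M : nat) (hn : (1 <= n)%N) (hr : r = (2 ^ n)%N)
    (hM : M = (10 ^ (2 ^ n) + 1)%N)
    (hx : forall x : nat, (1 < x < 5 ^ r)%N -> x ^ 4 = 1 %[mod 5 ^ r] ->
            ~~ (x %| M)%N) :
  prime M <->
  (eqmodL M (S1 toC (r - 1)) 1 /\ eqmodL M (S2 toC (r - 1)) (- 1)).
Proof.
rewrite -hr in hM.
have r1 : (1 < r)%N by rewrite hr -{1}(expn0 2) ltn_exp2l.
(* r is even and 10^2 is 1 modulo 11. *)
have M11 : M = 2 %[mod 11].
  rewrite hM hr -(prednK hn) expnS expnM -modnDml -modnXm (_ : 10 ^ 2 %% 11 = 1)%N //.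
  by rewrite exp1n.
have M10 : (M %% 10 = 1)%N.
  by rewrite hM -(subnK (ltnW r1)) expnD expn1 -modnDml modnMl.
have M110 : coprime M 110.
  rewrite (_ : 110 = 10 * 11)%N // coprimeMr -coprime_modl M10 /=.
  by rewrite -coprime_modl M11.
have co11 k : coprime (11 ^ k) M.
  by apply: coprimeXl; rewrite coprime_sym; apply: coprime_dvdr M110.
have [m1 [m2 mE]] := S12F_int (10 ^ (r - 1)).
set e := (3 * 10 ^ (r - 1) * 2)%N in mE.
have n11L : 11%:R != 0 :> L by rewrite -(rmorph_nat (in_alg L)) fmorph_eq0 pnatr_eq0.
(* The same [m1] and [m2] are used again below in positive characteristic. *)
have [mL1 mL2] := mE _ _ (rootPhi5_zeta5 hL) n11L.
rewrite -S1E // -natrX in mL1; rewrite -S2E // -natrX in mL2.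
have e0 : (0 < 11 ^ e)%N by rewrite expn_gt0.
rewrite (eqmodL_int 1 e0 (co11 e) mL1) -(rmorphN1 (intr : int -> L)).
rewrite (eqmodL_int (- 1) e0 (co11 e) mL2).
split=> [Mp | [d1 d2]].
  have [K [w [MK Hw s1 s2]]] := S12F_of_prime Mp r1 hM M11.
  have n11 : 11%:R != 0 :> K by apply: (natr_pchar_neq0 MK); rewrite -(expn1 11).
  have [k1 k2] := mE _ _ Hw n11.
  rewrite s1 mulr1 in k1; rewrite s2 mulrN1 in k2.
  rewrite !(dvdz_pcharf MK) !rmorphB !rmorphM rmorphN1 rmorph1 /= -!pmulrn !natrX.
  by rewrite -k1 -k2 mul1r mulN1r opprK subrr addNr eqxx.
have M1 : (1 < M)%N by rewrite hM addn1 ltnS expn_gt0.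
apply: contraT => /(contra (ltn_pdiv2_prime (ltnW M1))).
set q := pdiv M; rewrite -leqNgt => q2.
have qp : prime q by exact: pdiv_prime.
have qM : (q %| M)%N by exact: pdiv_dvd.
have [K [w [_ [qK Hw _]]]] := exists_roots_pchar qp.
have q110 : coprime q 110 by apply: coprime_dvdl M110.
have n11 : 11%:R != 0 :> K.
  by apply: (natr_pchar_neq0 qK); rewrite coprime_sym; apply: coprime_dvdr q110.
have n11e : 11%:R ^+ e != 0 :> K by rewrite expf_neq0.
have [k1 k2] := mE _ _ Hw n11.
have ms m k : (M %| m - k * (11 ^ e)%N%:Z)%Z -> m%:~R = k%:~R * 11%:R ^+ e :> K.
  move=> dm; apply/eqP; rewrite -subr_eq0 -natrX pmulrn -rmorphM -rmorphB.
  by rewrite -(dvdz_pcharf qK); apply: dvdz_trans dm.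
have s1 : S1F w (10 ^ (r - 1)) = 1.
  by apply: (mulfI n11e); rewrite k1 (ms _ _ d1) mul1r mulr1.
have s2 : S2F w (10 ^ (r - 1)) = - 1.
  by apply: (mulfI n11e); rewrite k2 (ms _ _ d2) mulrC.
have d5 := dvdn_pchar_order qK Hw q110 s1 s2.
rewrite subn1 prednK in d5; last exact: ltnW.
have q4 : q ^ 4 = 1 %[mod 5 ^ r].
  by apply/eqP; rewrite eqn_mod_dvd ?expn_gt0 ?prime_gt0.
have qr : (5 ^ r <= q)%N.
  rewrite leqNgt; apply/negP => qr.
  by have := hx q; rewrite prime_gt1 // qr qM => /(_ isT q4).
have : (5 ^ r * 5 ^ r <= M)%N by apply: leq_trans q2; rewrite -mulnn leq_mul.
rewrite -expnMn leqNgt hM => /negP[].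
(* The intermediate bound absorbs the added 1: 10^r + 1 <= 11^r < 25^r. *)
rewrite addn1; apply: (@leq_ltn_trans (11 ^ r)); first by rewrite ltn_exp2r // ltnW.
by rewrite (ltn_exp2r _ (5 * 5)) // ltnW.
Qed.
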